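(* In the setting of the context, let $k\neq k'$ be cells such that cell $k'$ aligns its interference at cell $k$. Then the total residual interference to noise ratio (RINR) $\mathcal I^k$ to cell $k$ satisfies $$\mathcal I^{k}\le\overline{\mathcal I}^{k}:=L\,\overline{\mathcal I}_{k'}^{i,k},$$ where $$\overline{\mathcal I}_{k'}^{i,k}:=c(N_U,d_s)\sum_{j=1}^L\frac{P_{j,k'}}{\sigma_k^2d_s}\,\lambda_1(\boldsymbol\Omega_{j,k'}^{k})\,2^{-\frac{B_{j,k'}}{d_s(N_U-d_s)}}$$ (which does not depend on $i$) is an upper bound of $\mathcal I_{k'}^{i,k}$ for every $i=1,\dots,L$, and $$\boldsymbol\Omega_{j,k'}^{k}:=\big(\boldsymbol V_{j,k'}^{in,\perp}\big)^H(\boldsymbol H_{j,k'}^{k})^H\,\boldsymbol\Pi^{\perp}_{\boldsymbol H_{j,k'}^{k}\boldsymbol V_{j,k'}^{in}}\,\boldsymbol H_{j,k'}^{k}\boldsymbol V_{j,k'}^{in,\perp}.$$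
   Context: System: there are $K\ge2$ cells, each with one base station (BS) with $N_B$ antennas and $L\ge2$ users with $N_U$ antennas each, $d_s$ streams per user, where $N_B=((K-1)L+1)d_s$ and $N_U=\frac{L-1}{L}N_B+\frac1Ld_s$ (so $N_U\ge 2d_s$). User $i$ of cell $k$ is $(i,k)$, with transmit power $P_{i,k}>0$; the noise variance at BS $k$ is $\sigma_k^2>0$; $\boldsymbol H_{i,k}^\ell\in\mathbb C^{N_B\times N_U}$ is the channel from user $(i,k)$ to BS $\ell$, assumed of full column rank. Notation: $\lambda_1(\cdot)$ is the largest eigenvalue; $\boldsymbol X^\perp$ is a matrix whose columns form an orthonormal basis of the left null space of $\boldsymbol X$ (so $(\boldsymbol X^\perp)^H\boldsymbol X=\boldsymbol 0$), and $\boldsymbol V_{j,k'}^{in,\perp}:=(\boldsymbol V_{j,k'}^{in})^\perp$; $\boldsymbol\Pi_{\boldsymbol X}^\perp=\boldsymbol I-\boldsymbol X(\boldsymbol X^H\boldsymbol X)^{-1}\boldsymbol X^H$. Alignment: ''cell $k'$ aligns its interference at cell $k$'' means that the inner precoders $\boldsymbol V_{i,k'}^{in}\in\mathbb C^{N_U\times d_s}$ (of full column rank) satisfy $\boldsymbol H_{1,k'}^k\boldsymbol V_{1,k'}^{in}=\cdots=\boldsymbol H_{L,k'}^k\boldsymbol V_{L,k'}^{in}$. All cells use inner precoders $\boldsymbol V_{i,\ell}^{in}\in\mathbb C^{N_U\times d_s}$ of full column rank, with precoder patterns $\overrightarrow{\boldsymbol V}_{i,\ell}=\boldsymbol V_{i,\ell}^{in}\big((\boldsymbol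 V_{i,\ell}^{in})^H\boldsymbol V_{i,\ell}^{in}\big)^{-1/2}$. Limited feedback: each $\overrightarrow{\boldsymbol V}_{i,\ell}$ is quantized with $B_{i,\ell}$ bits to $\widehat{\boldsymbol V}_{i,\ell}$, the element of a codebook of $2^{B_{i,\ell}}$ matrices in $\mathbb C^{N_U\times d_s}$ with orthonormal columns that minimizes the squared chordal distance $d_c^2(\boldsymbol V,\boldsymbol W)=d_s-\mathrm{Tr}(\boldsymbol V\boldsymbol V^H\boldsymbol W\boldsymbol W^H)$ to $\overrightarrow{\boldsymbol V}_{i,\ell}$. Standing assumption on the (Grassmannian sphere-packing) codebooks: the quantization distortion satisfies $$d_c^2(\overrightarrow{\boldsymbol V}_{i,\ell},\widehat{\boldsymbol V}_{i,\ell})\le c(N_U,d_s)\,2^{-\frac{B_{i,\ell}}{d_s(N_U-d_s)}},$$ where $c(M,N)=c^{-1/(N(M-N))}$ is a positive constant, $c$ being the leading coefficient of the normalized volume $c\,\delta^{2N(M-N)}$ of a chordal-distance ball of radius $\delta$ in the Grassmann manifold of $N$-dimensional subspaces of $\mathbb C^M$. Decoders: for each user $(i,k)$, $$\widehat{\boldsymbol U}_{i,k}=\Big(\big[\widehat{\boldsymbol F}_{i,k}^{IUI},\ \{\widehat{\boldsymbol F}_\ell^k\}_{\ell\ne k,k'},\ \boldsymbol H_{i,k'}^k\boldsymbol V_{i,k'}^{in}\big]\Big)^\perp ,$$ where $\widehat{\boldsymbol F}_{i,k}^{IUI}=[\boldsymbol H_{j,k}^k\widehat{\boldsymbol V}_{j,k}]_{j\ne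 i}$ and $\widehat{\boldsymbol F}_\ell^k=[\boldsymbol H_{1,\ell}^k\widehat{\boldsymbol V}_{1,\ell},\dots,\boldsymbol H_{L,\ell}^k\widehat{\boldsymbol V}_{L,\ell}]$. RINR: the RINR from cell $k'$ to user $(i,k)$ is $$\mathcal I_{k'}^{i,k}=\mathrm{Tr}\Big(\widehat{\boldsymbol U}_{i,k}^H\sum_{j=1}^L\frac{P_{j,k'}}{d_s\sigma_k^2}\boldsymbol H_{j,k'}^k\widehat{\boldsymbol V}_{j,k'}\widehat{\boldsymbol V}_{j,k'}^H(\boldsymbol H_{j,k'}^k)^H\widehat{\boldsymbol U}_{i,k}\Big).$$ Since the decoders null the inter-user interference and the interference from all cells other than $k'$, the total RINR to cell $k$ is $\mathcal I^k=\mathcal I_{k'}^k=\sum_{i=1}^L\mathcal I_{k'}^{i,k}$. *)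

(* Defs.v *)
From HB Require Import structures.
From mathcomp Require Export all_boot all_order all_algebra.
From mathcomp Require Export sesquilinear spectral complex.
From mathcomp Require Export all_classical all_reals all_analysis.
Set Implicit Arguments.
Unset Strict Implicit.
Unset Printing Implicit Defensive.
Export Order.TTheory GRing.Theory Num.Theory.
Export numFieldNormedType.Exports.
Global Open Scope classical_set_scope.
Global Open Scope ring_scope.
Global Open Scope complex_scope.
Global Open Scope sesquilinear_scope.

Definition orthonormal_cols (R : realType) (m n : nat) (V : 'M[R[i]]_(m, n)) :=
  V^t* *m V = 1%:M.

(* [U] is a choice of X^perp.  In MathComp [kermx X] has for row space
   {u | u *m X = 0}, so the second clause says that the columns of [U] span the
   left null space {x | x^t* *m X = 0}; the first makes them orthonormal.  The
   number [r] of columns is thus forced to be m - \rank X. *)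
Definition is_perp (R : realType) (m n r : nat)
    (X : 'M[R[i]]_(m, n)) (U : 'M[R[i]]_(m, r)) :=
  orthonormal_cols U /\ (U^t* :=: kermx X)%MS.

Definition proj_perp (R : realType) (m n : nat) (X : 'M[R[i]]_(m, n)) :
    'M[R[i]]_m :=
  1%:M - X *m invmx (X^t* *m X) *m X^t*.

(* Used on Hermitian matrices only, whose eigenvalues are all real. *)
Definition lambda1 (R : realType) (n : nat) (A : 'M[R[i]]_n) : R :=
  sup [set x : R | eigenvalue A x%:C].

(* A^(-1/2) for A Hermitian positive definite, by functional calculus on the
   spectral decomposition A = Q^t* *m diag_mx d *m Q, Q unitary. *)
Definition invsqrtmx (R : realType) (n : nat) (A : 'M[R[i]]_n) : 'M[R[i]]_n :=
  (spectralmx A)^t*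
    *m diag_mx (map_mx (fun x => (sqrtC x)^-1) (spectral_diag A))
    *m spectralmx A.

Definition precoder_pattern (R : realType) (m n : nat) (V : 'M[R[i]]_(m, n)) :
    'M[R[i]]_(m, n) :=
  V *m invsqrtmx (V^t* *m V).

(* The trace is a real number, as the trace of a product of two Hermitian
   matrices; [complex.Re] only changes its type. *)
Definition chordal2 (R : realType) (m n : nat) (V W : 'M[R[i]]_(m, n)) : R :=
  n%:R - complex.Re (\tr (V *m V^t* *m W *m W^t*)).

(* [W] is the quantization of [V] on [B] bits with codebook [Cb]. *)
Definition is_quantization (R : realType) (m n B : nat)
    (Cb : (2 ^ B).-tuple 'M[R[i]]_(m, n)) (V W : 'M[R[i]]_(m, n)) :=
  W \in Cb /\ forall W' : 'M[R[i]]_(m, n), W' \in Cb ->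
    chordal2 V W <= chordal2 V W'.

(* The N-dimensional subspaces of C^M, each identified with the orthogonal
   projector onto it. *)
Definition grassmannian (R : realType) (M N : nat) : set 'M[R[i]]_M :=
  [set W *m W^t* | W in [set W : 'M[R[i]]_(M, N) | orthonormal_cols W]].

(* The ball of radius [d] centered at the span of the columns of [V]. *)
Definition chordal_ball (R : realType) (M N : nat) (V : 'M[R[i]]_(M, N))
    (d : R) : set 'M[R[i]]_M :=
  [set W *m W^t* | W in
    [set W : 'M[R[i]]_(M, N) | orthonormal_cols W /\ chordal2 V W <= d ^+ 2]].

Definition borel_mx (R : realType) (M : nat) :=
  g_sigma_algebraType (@open 'M[(R[i] : numFieldType)]_M).

(* The normalized volume is the unitarily invariant Borel probability on the
   Grassmannian; the unitary Q sends the subspace with projector X to the one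
   with projector Q *m X *m Q^t*. *)
Definition is_normalized_volume (R : realType) (M N : nat)
    (mu : probability (borel_mx R M) R) :=
  mu (@grassmannian R M N) = 1%E /\
  forall (Q : 'M[R[i]]_M) (A : set (borel_mx R M)),
    Q \is unitarymx -> measurable A ->
    mu [set X : 'M[R[i]]_M | A (Q *m X *m Q^t*)] = mu A.

(* The normalized volume of a ball of radius d is equivalent to
   c * d ^ (2 N (M - N)) as d tends to 0. *)
Definition volume_leading_coef (R : realType) (M N : nat) (c : R) :=
  0 < c /\
  exists2 mu : probability (borel_mx R M) R, is_normalized_volume N mu &
    forall V : 'M[R[i]]_(M, N), orthonormal_cols V ->
      fine (mu (chordal_ball V d)) / d ^+ (2 * N * (M - N)) @[d --> 0^'+] --> c.

(* c(M, N), where [c] is the coefficient of [volume_leading_coef]. *)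
Definition distortion_const (R : realType) (c : R) (M N : nat) : R :=
  c `^ (- (N * (M - N))%:R^-1).

Definition distortion_bound (R : realType) (c : R) (NU ds B : nat) : R :=
  distortion_const c NU ds * 2 `^ (- (B%:R / (ds * (NU - ds))%:R)).

(* [F_t]_{t in A}, the blocks being put side by side in the order of [enum A]. *)
Definition block_row (R : realType) (m n : nat) (I : finType) (A : {set I})
    (F : I -> 'M[R[i]]_(m, n)) : 'M[R[i]]_(m, \sum_(t < #|A|) n) :=
  \mxrow_(t < #|A|) F (enum_val t).

(* Conventions: [i j : 'I_L] are users and [k k' l : 'I_K] are cells; [H i l k]
   is the channel from user i of cell l to the base station of cell k, and
   per-user data are indexed by the user, then its cell. *)

Definition aligns_at (R : realType) (K L NB NU ds : nat)
    (H : 'I_L -> 'I_K -> 'I_K -> 'M[R[i]]_(NB, NU))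
    (Vin : 'I_L -> 'I_K -> 'M[R[i]]_(NU, ds)) (k' k : 'I_K) :=
  forall i j : 'I_L, H i k' k *m Vin i k' = H j k' k *m Vin j k'.

Definition IUI_mx (R : realType) (K L NB NU ds : nat)
    (H : 'I_L -> 'I_K -> 'I_K -> 'M[R[i]]_(NB, NU))
    (Vhat : 'I_L -> 'I_K -> 'M[R[i]]_(NU, ds)) (i : 'I_L) (k : 'I_K) :=
  block_row [set~ i] (fun j => H j k k *m Vhat j k).

Definition ICI_mx (R : realType) (K L NB NU ds : nat)
    (H : 'I_L -> 'I_K -> 'I_K -> 'M[R[i]]_(NB, NU))
    (Vhat : 'I_L -> 'I_K -> 'M[R[i]]_(NU, ds)) (l k : 'I_K) :=
  block_row [set: 'I_L] (fun j => H j l k *m Vhat j l).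

(* The matrix whose left null space is used by the decoder of user i of cell k,
   when cell k' is the one aligning its interference. *)
Definition decoder_mx (R : realType) (K L NB NU ds : nat)
    (H : 'I_L -> 'I_K -> 'I_K -> 'M[R[i]]_(NB, NU))
    (Vin Vhat : 'I_L -> 'I_K -> 'M[R[i]]_(NU, ds))
    (k k' : 'I_K) (i : 'I_L) :=
  row_mx (row_mx (IUI_mx H Vhat i k)
                 (block_row (~: [set k; k']) (fun l => ICI_mx H Vhat l k)))
         (H i k' k *m Vin i k').

(* The RINR at base station k, after decoding by [U], caused by the users [J]
   of cell l.  The trace is that of a positive semidefinite matrix, hence real.
   [J = [set: 'I_L]] gives the RINR from the other cell l; with l = k and
   J = [set~ i] it is the residual inter-user interference of user i. *)
Definition rinr (R : realType) (K L NB NU ds r : nat)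
    (H : 'I_L -> 'I_K -> 'I_K -> 'M[R[i]]_(NB, NU))
    (P : 'I_L -> 'I_K -> R) (sigma2 : 'I_K -> R)
    (Vhat : 'I_L -> 'I_K -> 'M[R[i]]_(NU, ds))
    (k l : 'I_K) (J : {set 'I_L}) (U : 'M[R[i]]_(NB, r)) : R :=
  complex.Re (\tr (U^t* *m
    (\sum_(j in J) (P j l / (ds%:R * sigma2 k))%:C *:
       (H j l k *m Vhat j l *m (Vhat j l)^t* *m (H j l k)^t*)) *m U)).

(* All residual interference in cell k: inter-user interference, and
   interference from every other cell. *)
Definition total_rinr (R : realType) (K L NB NU ds : nat)
    (H : 'I_L -> 'I_K -> 'I_K -> 'M[R[i]]_(NB, NU))
    (P : 'I_L -> 'I_K -> R) (sigma2 : 'I_K -> R)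
    (Vhat : 'I_L -> 'I_K -> 'M[R[i]]_(NU, ds))
    (k : 'I_K) (r : 'I_L -> nat) (U : forall i : 'I_L, 'M[R[i]]_(NB, r i)) : R :=
  \sum_(i < L) (rinr H P sigma2 Vhat k k [set~ i] (U i) +
    \sum_(l < K | l != k) rinr H P sigma2 Vhat k l [set: 'I_L] (U i)).

(* Omega_{j,k'}^k, for G = H_{j,k'}^k, V = V_{j,k'}^in and Vp = V^perp. *)
Definition Omega (R : realType) (NB NU ds r : nat) (G : 'M[R[i]]_(NB, NU))
    (V : 'M[R[i]]_(NU, ds)) (Vp : 'M[R[i]]_(NU, r)) : 'M[R[i]]_r :=
  Vp^t* *m G^t* *m proj_perp (G *m V) *m G *m Vp.

Definition rinr_bound (R : realType) (K L NB NU ds r : nat) (c : R)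
    (H : 'I_L -> 'I_K -> 'I_K -> 'M[R[i]]_(NB, NU))
    (P : 'I_L -> 'I_K -> R) (sigma2 : 'I_K -> R) (B : 'I_L -> 'I_K -> nat)
    (Vin : 'I_L -> 'I_K -> 'M[R[i]]_(NU, ds))
    (Vperp : 'I_L -> 'M[R[i]]_(NU, r)) (k k' : 'I_K) : R :=
  distortion_const c NU ds *
  \sum_(j < L) P j k' / (sigma2 k * ds%:R) *
    lambda1 (Omega (H j k' k) (Vin j k') (Vperp j)) *
    2 `^ (- ((B j k')%:R / (ds * (NU - ds))%:R)).

(* Main.v *)
(** A decoder [U] kills the aligned interference [G V] ([G] the channel, [V] the
    inner precoder), so only the component orthogonal to [V] of the quantized
    precoder [Vh] leaks: [U^H G Vh = U^H G Vp Y] with [Y = Vp^H Vh].  Since the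
    columns of [U] are orthonormal and orthogonal to [G V], [U U^H] is dominated
    by the projector onto the orthogonal complement of [G V].  The leaked power
    is thus at most [Tr (Y^H Omega Y) <= lambda_1(Omega) Tr (Y^H Y)], and
    [Tr (Y^H Y)] is the squared chordal distance between [V] and [Vh]. *)

Require Import Defs.
From mathcomp Require Import ring.

Set Implicit Arguments.
Unset Strict Implicit.
Unset Printing Implicit Defensive.

(** * Gram matrices and the spectral theorem for Hermitian matrices *)

Section Adjoint.
Variable C : numClosedFieldType.

Lemma adjmxM m n p (A : 'M[C]_(m, n)) (B : 'M[C]_(n, p)) :
  (A *m B)^t* = B^t* *m A^t*.
Proof. by rewrite trmx_mul map_mxM. Qed.

Lemma adjmx1 n : (1%:M : 'M[C]_n)^t* = 1%:M.
Proof. by rewrite trmx1 map_mx1. Qed.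

Lemma adjmxB m n (A B : 'M[C]_(m, n)) : (A - B)^t* = A^t* - B^t*.
Proof. by rewrite linearB /= map_mxB. Qed.

Lemma adjmx0 m n : (0 : 'M[C]_(m, n))^t* = 0.
Proof. by rewrite trmx0 map_mx0. Qed.

Lemma adjmx_inv n (A : 'M[C]_n) : (invmx A)^t* = invmx (A^t*).
Proof. by rewrite trmx_inv map_invmx. Qed.

Lemma gram_diag_ge0 m n (A : 'M[C]_(m, n)) i : 0 <= (A^t* *m A) i i.
Proof.
rewrite mxE sumr_ge0 // => j _; rewrite !mxE mulrC.
exact: mul_conjC_ge0.
Qed.

Lemma mxtrace_gram_ge0 m n (A : 'M[C]_(m, n)) : 0 <= \tr (A^t* *m A).
Proof. by rewrite sumr_ge0 // => i _; exact: gram_diag_ge0. Qed.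

Lemma gram_eq0 m n (A : 'M[C]_(m, n)) : A^t* *m A = 0 -> A = 0.
Proof.
move=> A0; apply/matrixP => j i; have /matrixP/(_ i i) := A0.
rewrite !mxE => /eqP; rewrite psumr_eq0 => [|l _]; last first.
  by rewrite !mxE mulrC mul_conjC_ge0.
move=> /allP/(_ j (mem_index_enum _)); rewrite !mxE mulrC mul_conjC_eq0.
by move=> /eqP.
Qed.

(** If [v] kills the Gram matrix, then [X *m v^t*] has zero Gram matrix, hence vanishes, and full
    column rank forces [v = 0]. *)
Lemma gram_unitmx m n (X : 'M[C]_(m, n)) :
  \rank X = n -> X^t* *m X \in unitmx.
Proof.
move=> rX; rewrite -row_free_unit; apply: inj_row_free => v vX.
have fX : row_free (X^t*) by rewrite /row_free mxrank_map mxrank_tr rX.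
have /gram_eq0 Xv0 : (X *m v^t*)^t* *m (X *m v^t*) = 0.
  by rewrite adjmxM trmxCK !mulmxA -(mulmxA v) vX mul0mx.
apply/eqP; rewrite -(mulmx_free_eq0 v fX).
by rewrite -[v]trmxCK -adjmxM Xv0 adjmx0.
Qed.

Lemma hermitian_spectral n (A : 'M[C]_n) : A^t* = A ->
  A = (spectralmx A)^t* *m diag_mx (spectral_diag A) *m spectralmx A.
Proof.
move=> hA; rewrite -invmx_unitary ?spectral_unitarymx //.
apply/orthomx_spectralP/hermitian_normalmx/is_hermitianmxP.
by rewrite expr0 scale1r hA.
Qed.

Lemma spectralmxK n (A : 'M[C]_n) : spectralmx A *m (spectralmx A)^t* = 1%:M.
Proof. exact/unitarymxP/spectral_unitarymx. Qed.

Lemma spectralmxKV n (A : 'M[C]_n) : (spectralmx A)^t* *m spectralmx A = 1%:M.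
Proof. exact/mulmx1C/spectralmxK. Qed.

(** Reading eigenvalues as diagonal entries of a unitary conjugate lets the positivity of Gram
    matrices pass to their spectrum. *)
Lemma spectral_diagE n (A : 'M[C]_n) i : A^t* = A ->
  spectral_diag A 0 i = (spectralmx A *m A *m (spectralmx A)^t*) i i.
Proof.
move=> hA; rewrite {3}(hermitian_spectral hA) !mulmxA spectralmxK mul1mx.
by rewrite -mulmxA spectralmxK mulmx1 mxE eqxx mulr1n.
Qed.

Lemma spectral_diag_real n (A : 'M[C]_n) i : A^t* = A ->
  spectral_diag A 0 i \is Num.real.
Proof.
move=> hA; apply/mxOverP/hermitian_spectral_diag_real/is_hermitianmxP.
by rewrite expr0 scale1r hA.
Qed.

Lemma gram_adj m n (X : 'M[C]_(m, n)) : (X^t* *m X)^t* = X^t* *m X.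
Proof. by rewrite adjmxM trmxCK. Qed.

Lemma spectral_diag_gram_ge0 m n (X : 'M[C]_(m, n)) i :
  0 <= spectral_diag (X^t* *m X) 0 i.
Proof.
rewrite spectral_diagE ?gram_adj //; set Q := spectralmx _.
have -> : Q *m (X^t* *m X) *m Q^t* = (X *m Q^t*)^t* *m (X *m Q^t*).
  by rewrite adjmxM trmxCK !mulmxA.
exact: gram_diag_ge0.
Qed.

End Adjoint.

(** * Inverse square roots and the largest eigenvalue *)

Section Precoding.
Variable R : realType.
Notation C := R[i].

(** Nonnegative eigenvalues have real square roots, so [S] is Hermitian; invertibility makes them
    nonzero, so [S *m S *m A = 1%:M] can be checked on the diagonal factors. *)
Lemma invsqrtmx_gram m n (X : 'M[C]_(m, n)) : X^t* *m X \in unitmx ->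
  let S := invsqrtmx (X^t* *m X) in
  S^t* = S /\ S *m S = invmx (X^t* *m X).
Proof.
set A := X^t* *m X => uA S; have hA : A^t* = A by exact: gram_adj.
have Sh : S^t* = S.
  rewrite /S /invsqrtmx !adjmxM trmxCK mulmxA; congr (_ *m _ *m _).
  rewrite tr_diag_mx map_diag_mx; congr diag_mx; apply/matrixP => i j.
  rewrite !mxE ord1; apply/CrealP; rewrite rpredV ger0_real // sqrtC_ge0.
  exact: spectral_diag_gram_ge0.
split=> //.
have dN0 i : spectral_diag A 0 i != 0.
  have : diag_mx (spectral_diag A) \in unitmx.
    have := uA; rewrite {1}(hermitian_spectral hA) !unitmx_mul.
    by move=> /andP[/andP[]].
  by rewrite unitmxE det_diag unitfE => /prodf_neq0; apply.
suff SSA : S *m S *m A = 1%:M by rewrite -[LHS](mulmxK uA) SSA mul1mx.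
rewrite [X in _ *m X](hermitian_spectral hA) /S /invsqrtmx.
set Q := spectralmx A; set E := diag_mx (map_mx _ _); set D := diag_mx _.
have QQ : Q *m Q^t* = 1%:M by exact: spectralmxK.
have EED : E *m E *m D = 1%:M.
  rewrite !mulmx_diag -diag_const_mx; congr diag_mx; apply/rowP => i.
  by rewrite !mxE -expr2 exprVn sqrtCK mulVf.
have -> : Q^t* *m E *m Q *m (Q^t* *m E *m Q) *m (Q^t* *m D *m Q)
    = Q^t* *m (E *m (Q *m Q^t*) *m E *m (Q *m Q^t*) *m D) *m Q.
  by rewrite !mulmxA.
by rewrite QQ !mulmx1 EED mulmx1 spectralmxKV.
Qed.

Lemma lambda1_ub n (A : 'M[C]_n) (x : R) : A^t* = A ->
  eigenvalue A x%:C -> x <= lambda1 A.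
Proof.
move=> hA ex; apply: ub_le_sup => //.
(* The supremum is meaningful only for a bounded set. Every real eigenvalue is an entry of the
   spectral diagonal, as a nonzero coordinate of [v] in the eigenbasis shows, so the sum of absolute
   values bounds them all. *)
exists (\sum_i `|complex.Re (spectral_diag A 0 i)|) => y /eigenvalueP[v vA vN0].
pose w := v *m (spectralmx A)^t*.
have wd : w *m diag_mx (spectral_diag A) = y%:C *: w.
  rewrite /w scalemxAl -vA [X in _ = v *m X *m _](hermitian_spectral hA).
  rewrite !mulmxA.
  by rewrite -[RHS]mulmxA spectralmxK mulmx1.
have [i wi] : exists i, w 0 i != 0.
  apply/existsP; apply: contraNT vN0 => /existsPn w0.
  have -> : v = w *m spectralmx A.
    by rewrite /w -mulmxA spectralmxKV mulmx1.
  suff -> : w = 0 by rewrite mul0mx.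
  by apply/rowP => i; rewrite [RHS]mxE; apply/eqP; rewrite -[_ == _]negbK w0.
have : w 0 i * spectral_diag A 0 i = y%:C * w 0 i.
  by have /rowP/(_ i) := wd; rewrite mul_mx_diag mxE [RHS]mxE.
rewrite mulrC => /(mulIf wi) dy.
by rewrite (le_trans (ler_norm _)) // (bigD1 i) //= dy lerDl sumr_ge0.
Qed.

Lemma spectral_eigenvalue n (A : 'M[C]_n) i : A^t* = A ->
  eigenvalue A (spectral_diag A 0 i).
Proof.
move=> hA; apply/eigenvalueP; exists (row i (spectralmx A)).
  rewrite {2}(hermitian_spectral hA) -row_mul !mulmxA spectralmxK mul1mx.
  by apply/rowP => j; rewrite mxE mul_diag_mx !mxE.
apply/eqP => /(congr1 (fun w => w *m (spectralmx A)^t*)).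
rewrite /= -row_mul spectralmxK mul0mx => /rowP/(_ i).
by rewrite !mxE eqxx => /eqP; rewrite oner_eq0.
Qed.

Lemma mxtrace_le_lambda1 n p (A : 'M[C]_n) (Y : 'M[C]_(n, p)) : A^t* = A ->
  \tr (Y^t* *m A *m Y) <= (lambda1 A)%:C * \tr (Y^t* *m Y).
Proof.
move=> hA; pose Z := spectralmx A *m Y.
have -> : Y^t* *m Y = Z^t* *m Z.
  by rewrite adjmxM mulmxA -(mulmxA (Y^t*)) spectralmxKV mulmx1.
have -> : Y^t* *m A *m Y = Z^t* *m diag_mx (spectral_diag A) *m Z.
  by rewrite {1}(hermitian_spectral hA) adjmxM !mulmxA.
(* By cyclicity, both traces become sums over the nonnegative diagonal entries of [Z *m Z^t*],
   weighted by the eigenvalues on the left and by [lambda1 A] on the right. *)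
rewrite -mulmxA mxtrace_mulC [in leRHS]mxtrace_mulC mulr_sumr.
rewrite -[X in X <= _]/(\sum_i _) ler_sum // => i _.
rewrite -mulmxA mul_diag_mx mxE ler_wpM2r //.
  by rewrite -{1}[Z]trmxCK gram_diag_ge0.
have dr := spectral_diag_real i hA.
rewrite -(RRe_real dr) lecR lambda1_ub // RRe_real //.
exact: spectral_eigenvalue.
Qed.

Lemma lambda1_gram_ge0 m n (X : 'M[C]_(m, n)) : 0 <= lambda1 (X^t* *m X).
Proof.
(* With no eigenvalue, as for a matrix of size 0, the supremum takes its default value 0. *)
have [E0|/set0P[x ex]] := eqVneq [set x : R | eigenvalue (X^t* *m X) x%:C] set0.
  by rewrite /lambda1 E0 sup0.
apply: le_trans (lambda1_ub (gram_adj X) ex).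
have /eigenvalueP[v vA vN0] := ex.
have vv_gt0 : 0 < \tr (v *m v^t*).
  rewrite -{1}[v]trmxCK lt_def mxtrace_gram_ge0 andbT.
  apply: contraNneq vN0 => tr0.
  rewrite -[v]trmxCK (gram_eq0 (A := v^t*)) ?adjmx0 //.
  by rewrite [LHS]mx11_scalar -trace_mx11 tr0 raddf0.
rewrite -ler0c -(pmulr_lge0 _ vv_gt0) -mxtraceZ scalemxAl -vA.
have -> : v *m (X^t* *m X) *m v^t* = (X *m v^t*)^t* *m (X *m v^t*).
  by rewrite adjmxM trmxCK !mulmxA.
exact: mxtrace_gram_ge0.
Qed.

Lemma precoder_pattern_proj m n (V : 'M[C]_(m, n)) : \rank V = n ->
  precoder_pattern V *m (precoder_pattern V)^t* =
  V *m invmx (V^t* *m V) *m V^t*.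
Proof.
move=> /gram_unitmx/invsqrtmx_gram[Sh SS].
by rewrite /precoder_pattern adjmxM Sh mulmxA -(mulmxA V) SS.
Qed.

(** * Orthogonal projectors and choices of the orthogonal complement *)

Section OrthogonalProjector.
Variables (m n : nat) (X : 'M[C]_(m, n)) (rX : \rank X = n).

Lemma proj_perpK : proj_perp X *m X = 0.
Proof.
rewrite /proj_perp mulmxBl mul1mx -!mulmxA mulVmx ?gram_unitmx //.
by rewrite mulmx1 subrr.
Qed.

Lemma adj_proj_perp : (proj_perp X)^t* = proj_perp X.
Proof.
rewrite /proj_perp adjmxB adjmx1 !adjmxM adjmx_inv gram_adj trmxCK.
by rewrite mulmxA.
Qed.

Lemma proj_perp_id p (Y : 'M[C]_(m, p)) : X^t* *m Y = 0 -> proj_perp X *m Y = Y.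
Proof.
move=> XY; rewrite /proj_perp mulmxBl mul1mx -(mulmxA _ (X^t*)) XY.
by rewrite mulmx0 subr0.
Qed.

Lemma proj_perp_idem : proj_perp X *m proj_perp X = proj_perp X.
Proof.
apply: proj_perp_id; rewrite -[LHS]trmxCK adjmxM trmxCK adj_proj_perp.
by rewrite proj_perpK adjmx0.
Qed.

(** The projector [U *m U^t*] is nested in [proj_perp X], so the difference is again an orthogonal
    projector. Writing it as its own Gram matrix gives its positivity. *)
Lemma proj_perp_sub_gram q (U : 'M[C]_(m, q)) :
    orthonormal_cols U -> U^t* *m X = 0 ->
  let E := proj_perp X - U *m U^t* in E^t* *m E = E.
Proof.
move=> UU UX E.
have XU : X^t* *m U = 0 by rewrite -[LHS]trmxCK adjmxM trmxCK UX adjmx0.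
have pU := proj_perp_id XU.
have Up : U^t* *m proj_perp X = U^t*.
  by rewrite -[LHS]trmxCK adjmxM trmxCK adj_proj_perp pU.
have -> : E^t* = E by rewrite /E adjmxB adj_proj_perp adjmxM trmxCK.
move: proj_perp_idem pU Up; rewrite /E; move: (proj_perp X) => p pp pU Up.
rewrite mulmxBl !mulmxBr pp -(mulmxA U _ p) Up !mulmxA pU.
by rewrite -(mulmxA U) UU mulmx1 subrr subr0.
Qed.

(** The rows of [proj_perp X] lie in the left kernel of [X], so it factors as [Y *m W^t*]; applying
    it to [W], which it fixes, yields [Y = W]. *)
Lemma is_perp_proj p (W : 'M[C]_(m, p)) :
  is_perp X W -> W *m W^t* = proj_perp X.
Proof.
move=> [WW Wker].
have WX : W^t* *m X = 0 by apply/sub_kermxP; rewrite Wker.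
have /submxP[Y pY] : (proj_perp X <= W^t*)%MS.
  by rewrite Wker; apply/sub_kermxP; exact: proj_perpK.
have XW : X^t* *m W = 0 by rewrite -[LHS]trmxCK adjmxM trmxCK WX adjmx0.
have := proj_perp_id XW; rewrite {1}pY -mulmxA WW mulmx1 => YW.
by rewrite pY YW.
Qed.

End OrthogonalProjector.

(** * Interference leaking through a decoder *)

Lemma Omega_gram (a m n p : nat) (G : 'M[C]_(a, m)) (V : 'M[C]_(m, n))
    (Vp : 'M[C]_(m, p)) : \rank (G *m V) = n ->
  let F := proj_perp (G *m V) *m G *m Vp in Omega G V Vp = F^t* *m F.
Proof.
move=> rGV; rewrite /Omega !adjmxM adj_proj_perp !mulmxA.
by rewrite -!(mulmxA _ (proj_perp _) (proj_perp _)) proj_perp_idem.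
Qed.

Lemma leakage_le (a m n p r : nat) (G : 'M[C]_(a, m)) (V Vh : 'M[C]_(m, n))
    (Vp : 'M[C]_(m, p)) (U : 'M[C]_(a, r)) :
  \rank V = n -> \rank (G *m V) = n -> orthonormal_cols Vh ->
  is_perp V Vp -> orthonormal_cols U -> U^t* *m (G *m V) = 0 ->
  complex.Re (\tr (U^t* *m (G *m Vh *m Vh^t* *m G^t*) *m U)) <=
  lambda1 (Omega G V Vp) * chordal2 (precoder_pattern V) Vh.
Proof.
move=> rV rGV hVh hVp hU UGV; pose Y := Vp^t* *m Vh; pose T := G *m Vp *m Y.
have VV := is_perp_proj rV hVp.
have OmE := Omega_gram Vp rGV.
have dE : complex.Re (\tr (Y^t* *m Y)) = chordal2 (precoder_pattern V) Vh.
  rewrite /chordal2 precoder_pattern_proj //; set M := V *m _ *m _.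
  have -> : \tr (Y^t* *m Y) = n%:R - \tr (M *m Vh *m Vh^t*).
    have -> : Y^t* *m Y = Vh^t* *m Vh - Vh^t* *m (M *m Vh).
      rewrite /Y adjmxM trmxCK mulmxA -(mulmxA (Vh^t*)) VV /proj_perp -/M.
      by rewrite mulmxBr mulmx1 mulmxBl !mulmxA.
    by rewrite linearB /= hVh mxtrace1 [in RHS]mxtrace_mulC.
  by rewrite raddfB /= -(rmorph_nat (real_complex R)) /=.
(* [Vp *m Vp^t*] differs from the identity by a matrix with left factor [V], which [U^t* *m G]
   kills. *)
have UT : U^t* *m (G *m Vh) = U^t* *m T.
  rewrite /T /Y !mulmxA -(mulmxA _ Vp) VV /proj_perp mulmxBr mulmx1 mulmxBl.
  by rewrite !mulmxA in UGV *; rewrite UGV !mul0mx subr0.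
rewrite -dE.
have -> : U^t* *m (G *m Vh *m Vh^t* *m G^t*) *m U =
    (U^t* *m T) *m (U^t* *m T)^t*.
  by rewrite -UT !adjmxM trmxCK !mulmxA.
have : \tr ((U^t* *m T) *m (U^t* *m T)^t*) <=
    (lambda1 (Omega G V Vp))%:C * \tr (Y^t* *m Y).
  apply: le_trans (mxtrace_le_lambda1 Y _); last by rewrite OmE gram_adj.
  rewrite mxtrace_mulC adjmxM trmxCK -subr_ge0 -linearB /=.
  (* The gap between the two traces is the squared Frobenius norm of [E *m T]. *)
  pose E := proj_perp (G *m V) - U *m U^t*.
  have EE : E^t* *m E = E by exact: proj_perp_sub_gram.
  have -> : Y^t* *m Omega G V Vp *m Y - T^t* *m U *m (U^t* *m T) =
      (E *m T)^t* *m (E *m T).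
    rewrite (adjmxM E T) [RHS]mulmxA -[in RHS](mulmxA (T^t*)) EE /E.
    rewrite mulmxBr mulmxBl.
    by rewrite /T /Omega !adjmxM !mulmxA.
  exact: mxtrace_gram_ge0.
rewrite lecE => /andP[_].
by case: (\tr (Y^t* *m Y)) => x y /=; rewrite mul0r subr0.
Qed.

Lemma block_row_null a m n (I : finType) (A : {set I}) (F : I -> 'M[C]_(m, n))
    (W : 'M[C]_(a, m)) i : i \in A -> W *m block_row A F = 0 -> W *m F i = 0.
Proof.
move=> iA; rewrite /block_row mul_mxrow => W0.
have := congr1 (fun M => submxrow M (enum_rank_in iA i)) W0.
by rewrite /= mxrowK enum_rankK_in // => ->; apply/matrixP => x y; rewrite !mxE.
Qed.

End Precoding.

Theorem proposition3 (R : realType) (K L ds NB NU : nat)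
    (hK : (2 <= K)%N) (hL : (2 <= L)%N) (hds : (1 <= ds)%N)
    (hNB : NB = (((K - 1) * L + 1) * ds)%N)
    (hNU : NU%:R = (L%:R - 1) / L%:R * NB%:R + L%:R^-1 * ds%:R :> R)
    (P : 'I_L -> 'I_K -> R) (hP : forall i l, 0 < P i l)
    (sigma2 : 'I_K -> R) (hsigma2 : forall k, 0 < sigma2 k)
    (H : 'I_L -> 'I_K -> 'I_K -> 'M[R[i]]_(NB, NU))
    (hH : forall i l k, \rank (H i l k) = NU)
    (Vin : 'I_L -> 'I_K -> 'M[R[i]]_(NU, ds))
    (hVin : forall i l, \rank (Vin i l) = ds)
    (B : 'I_L -> 'I_K -> nat)
    (Cb : forall i l, (2 ^ B i l).-tuple 'M[R[i]]_(NU, ds))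
    (hCb : forall i l W, W \in Cb i l -> orthonormal_cols W)
    (Vhat : 'I_L -> 'I_K -> 'M[R[i]]_(NU, ds))
    (hVhat : forall i l,
      is_quantization (Cb i l) (precoder_pattern (Vin i l)) (Vhat i l))
    (c : R) (hc : volume_leading_coef NU ds c)
    (hdist : forall i l,
      chordal2 (precoder_pattern (Vin i l)) (Vhat i l)
        <= distortion_bound c NU ds (B i l))
    (k k' : 'I_K) (hkk' : k != k')
    (halign : aligns_at H Vin k' k)
    (Vperp : 'I_L -> 'M[R[i]]_(NU, NU - ds))
    (hVperp : forall j, is_perp (Vin j k') (Vperp j))
    (r : 'I_L -> nat) (U : forall i : 'I_L, 'M[R[i]]_(NB, r i))
    (hU : forall i, is_perp (decoder_mx H Vin Vhat k k' i) (U i)) :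
  let Ibar := rinr_bound c H P sigma2 B Vin Vperp k k' in
  [/\ total_rinr H P sigma2 Vhat k U
        = \sum_(i < L) rinr H P sigma2 Vhat k k' [set: 'I_L] (U i),
      forall i, rinr H P sigma2 Vhat k k' [set: 'I_L] (U i) <= Ibar
    & total_rinr H P sigma2 Vhat k U <= L%:R * Ibar].
Proof.
move=> Ibar.
have Unull i : (U i)^t* *m decoder_mx H Vin Vhat k k' i = 0.
  by apply/sub_kermxP; case: (hU i) => _ ->.
have [UIUI [UICI Ual]] :
   (forall i j, j != i -> (U i)^t* *m (H j k k *m Vhat j k) = 0) /\
   (forall i j l, l != k -> l != k' -> (U i)^t* *m (H j l k *m Vhat j l) = 0) /\
   (forall i j, (U i)^t* *m (H j k' k *m Vin j k') = 0).
  split; last split; move=> i j.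
  - move=> ji; have := Unull i; rewrite /decoder_mx !mul_mx_row.
    move=> /eqP; rewrite row_mx_eq0 => /andP[]; rewrite row_mx_eq0.
    move=> /andP[/eqP + _] _.
    apply: (block_row_null (F := fun j => H j k k *m Vhat j k)).
    by rewrite !inE.
  - move=> l lk lk'; have := Unull i; rewrite /decoder_mx !mul_mx_row.
    move=> /eqP; rewrite row_mx_eq0 => /andP[]; rewrite row_mx_eq0.
    move=> /andP[_ /eqP U0] _.
    have lS : l \in ~: [set k; k'] by rewrite !inE negb_or lk.
    have {}U0 : (U i)^t* *m ICI_mx H Vhat l k = 0.
      exact: (block_row_null (F := fun l => ICI_mx H Vhat l k) lS U0).
    have jT : j \in [set: 'I_L]%SET by exact: finset.in_setT.
    exact: (block_row_null (F := fun j => H j l k *m Vhat j l) jT U0).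
  (* The decoder matrix contains only the block of user [i] of cell [k']; alignment identifies it
     with the block of every user [j]. *)
  - have := Unull i; rewrite /decoder_mx !mul_mx_row.
    by move=> /eqP; rewrite row_mx_eq0 => /andP[_ /eqP]; rewrite -(halign i j).
have rinr0 i l (J : {set 'I_L}) :
    (forall j, j \in J -> (U i)^t* *m (H j l k *m Vhat j l) = 0) ->
    rinr H P sigma2 Vhat k l J (U i) = 0.
  move=> UH; rewrite /rinr mulmx_sumr big1 ?mul0mx ?mxtrace0 // => j jJ.
  by rewrite -scalemxAr !mulmxA -(mulmxA ((U i)^t*)) UH // !mul0mx scaler0.
have totE : total_rinr H P sigma2 Vhat k U
        = \sum_(i < L) rinr H P sigma2 Vhat k k' [set: 'I_L] (U i).
  apply: eq_bigr => i _; rewrite rinr0 ?add0r; last first.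
    by move=> j; rewrite !inE; exact: UIUI.
  rewrite (bigD1 k') /=; last by rewrite eq_sym.
  rewrite big1 ?addr0 // => l /andP[lk lk'].
  by apply: rinr0 => j _; exact: UICI.
have rinr_le i : rinr H P sigma2 Vhat k k' [set: 'I_L] (U i) <= Ibar.
  rewrite /rinr mulmx_sumr mulmx_suml (raddf_sum (@mxtrace _ _)) raddf_sum.
  rewrite /Ibar /rinr_bound mulr_sumr /=.
  rewrite (eq_bigl xpredT) => [|j]; last by rewrite finset.in_setT.
  apply: ler_sum => j _.
  rewrite -scalemxAr -scalemxAl mxtraceZ.
  have ReZ (x : R) (z : R[i]) : complex.Re (x%:C * z) = x * complex.Re z.
    by case: z => a b /=; rewrite mul0r subr0.
  rewrite ReZ.
  have [hVhj _] := hVhat j k'.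
  have [UU _] := hU i.
  (* A channel of full column rank is injective, so it preserves the rank of the inner precoder. *)
  have rGV : \rank (H j k' k *m Vin j k') = ds.
    rewrite -mxrank_tr trmx_mul mxrankMfree ?mxrank_tr //.
    by rewrite /row_free mxrank_tr hH.
  have le := leakage_le (hVin j k') rGV (hCb _ _ _ hVhj) (hVperp j) UU
    (Ual i j).
  (* This sign allows the distortion bound to be multiplied by [lambda1]. *)
  have lam0 : 0 <= lambda1 (Omega (H j k' k) (Vin j k') (Vperp j)).
    by rewrite (Omega_gram (Vperp j) rGV) lambda1_gram_ge0.
  have := le_trans le (ler_wpM2l lam0 (hdist j k')).
  rewrite /distortion_bound => {}le.
  have c0 : 0 <= P j k' / (ds%:R * sigma2 k).
    by rewrite divr_ge0 ?mulr_ge0 ?ler0n // ltW.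
  apply: le_trans (ler_wpM2l c0 le) _.
  by rewrite (mulrC ds%:R) le_eqVlt; apply/orP; left; apply/eqP; ring.
split=> //.
rewrite totE (le_trans (ler_sum _ (fun i _ => rinr_le i))) //.
by rewrite sumr_const card_ord mulr_natl.
Qed.
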